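(* Let $\mathbb{F}$ be a field with $\operatorname{char}(\mathbb{F})\ne 2$, let $n\ge 2$, and let $\mathcal{J}$ be a $2$-torsion-free Jordan ring. A map $\phi:M_n(\mathbb{F})^+\to\mathcal{J}$ is Jordan multiplicative if and only if $e:=\phi(0)$ is an idempotent and there exists a Jordan ring homomorphism $\psi:M_n(\mathbb{F})^+\to\mathcal{J}_0(e)$ such that $$\phi(X)=e+\psi(X)\qquad\text{for all } X\in M_n(\mathbb{F}).$$ In this case, $\psi$ is either zero or injective. Consequently, a Jordan multiplicative map $\phi$ is either constant with idempotent value or injective.
   Context: A Jordan ring is an additive abelian group $\mathcal{J}$ with a biadditive commutative product $(x,y)\mapsto x\circ y$ (not assumed associative or unital) satisfying $x^2\circ(x\circ y)=x\circ(x^2\circ y)$ for all $x,y$, where $x^2:=x\circ x$. It is $2$-torsion-free if $2x=0$ implies $x=0$. An idempotent is an element $e$ with $e\circ e=e$. For an idempotent $e\in\mathcal{J}$, $\mathcal{J}_0(e):=\{x\in\mathcal{J}: e\circ x=0\}$; when $\mathcal{J}$ is $2$-torsion-free this is a Jordan subring (an additive subgroup closed under $\circ$). A map $\phi:\mathcal{J}_1\to\mathcal{J}_2$ between Jordan rings is Jordan multiplicative if $\phi(x\circ y)=\phi(x)\circ\phi(y)$ for all $x,y$ (no additivity is assumed); a Jordan ring homomorphism is an additive Jordan multiplicative map. $M_n(\mathbb{F})^+$ is the Jordan ring of all $n\times n$ matrices over $\mathbb{F}$ with product $X\circ Y:=\frac12(XY+YX)$. *)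

(* Defs.v *)
From HB Require Import structures.
From mathcomp Require Import all_boot all_order all_algebra.

Set Implicit Arguments.
Unset Strict Implicit.
Unset Printing Implicit Defensive.

Import GRing.Theory.
Local Open Scope ring_scope.

HB.mixin Record Zmodule_isJordanRing J of GRing.Zmodule J := {
  jmul : J -> J -> J;
  jmulC : commutative jmul;
  jmulDl : left_distributive jmul +%R;
  jordan_identity : forall x y : J,
    jmul (jmul x x) (jmul x y) = jmul x (jmul (jmul x x) y)
}.

#[short(type="jordanRingType")]
HB.structure Definition JordanRing :=
  { J of Zmodule_isJordanRing J & GRing.Zmodule J }.

Notation "x ∘ y" := (jmul x y) (at level 40, left associativity) : ring_scope.

Section JordanRingTheory.
Variable J : jordanRingType.
Implicit Types e x y : J.

Definition two_torsion_free := forall x, x *+ 2 = 0 -> x = 0.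

Definition jordan_idempotent e := e ∘ e = e.

Definition peirce0 e : {pred J} := [pred x | e ∘ x == 0].

Lemma jmulDr x : {morph jmul x : y z / y + z}.
Proof. by move=> y z; rewrite jmulC jmulDl !(jmulC x). Qed.

Lemma jmulr0 x : x ∘ 0 = 0.
Proof. by apply: (addrI (x ∘ 0)); rewrite -jmulDr !addr0. Qed.

Lemma jmul0r x : 0 ∘ x = 0.
Proof. by rewrite jmulC jmulr0. Qed.

Lemma jmulrN x y : x ∘ (- y) = - (x ∘ y).
Proof. by apply: (addrI (x ∘ y)); rewrite -jmulDr !subrr jmulr0. Qed.

Lemma jmulNr x y : (- x) ∘ y = - (x ∘ y).
Proof. by rewrite jmulC jmulrN jmulC. Qed.

Lemma peirce0_zmod_closed e : zmod_closed (peirce0 e).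
Proof.
split=> [|x y]; rewrite !inE ?jmulr0 // => /eqP ex0 /eqP ey0.
by rewrite jmulDr jmulrN ex0 ey0 subr0.
Qed.

Lemma peirce0_jmul_closed e : two_torsion_free -> jordan_idempotent e ->
  {in peirce0 e &, forall x y, x ∘ y \in peirce0 e}.
Proof.
move=> tf ee x y; rewrite !inE => /eqP ex0 /eqP ey0; apply/eqP/tf.
have xe0 : x ∘ e = 0 by rewrite jmulC.
have := jordan_identity (e - x) y; have := jordan_identity (e + x) y.
rewrite !(jmulDl, jmulDr, jmulrN, jmulNr, ee, ex0, ey0, xe0, jmulr0, jmul0r, opprK).
rewrite !(subr0, addr0, add0r, oppr0, jmulrN) jordan_identity.
move=> /addIr <- /eqP; rewrite opprK -subr_eq0 opprB addrA.
by rewrite subrK opprK -opprD oppr_eq0 mulr2n => /eqP.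
Qed.

End JordanRingTheory.

Definition jordan_multiplicative (J1 J2 : jordanRingType) (f : J1 -> J2) :=
  {morph f : x y / x ∘ y}.

Definition jordan_hom (J1 J2 : jordanRingType) (f : J1 -> J2) :=
  {morph f : x y / x + y} /\ jordan_multiplicative f.

(* When J2 is 2-torsion-free and e is idempotent, peirce0 e is a Jordan       *)
(* subring (peirce0_zmod_closed, peirce0_jmul_closed), so a homomorphism into *)
(* it is a homomorphism into J2 with values in peirce0 e.                     *)
Definition jordan_hom_to_peirce0 (J1 J2 : jordanRingType) (e : J2)
    (f : J1 -> J2) :=
  jordan_hom f /\ forall x, f x \in peirce0 e.

(* An alias of the matrix type, since n x n matrices already carry the        *)
(* associative ring structure.                                                *)
Definition jordan_matrix (F : fieldType) (n : nat) := 'M[F]_n.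

Notation "''M^+[' F ]_ n" := (jordan_matrix F n)
  (at level 0, n at level 2, format "''M^+[' F ]_ n") : type_scope.

Section JordanMatrix.
Variables (F : fieldType) (n : nat).

HB.instance Definition _ := GRing.Zmodule.on 'M^+[F]_n.

Definition jmulmx (X Y : 'M[F]_n) : 'M[F]_n := 2^-1 *: (X *m Y + Y *m X).

Fact jmulmxC : commutative jmulmx.
Proof. by move=> X Y; rewrite /jmulmx addrC. Qed.

Fact jmulmxDl : left_distributive jmulmx +%R.
Proof.
by move=> X Y Z; rewrite /jmulmx -scalerDr mulmxDl mulmxDr addrACA.
Qed.

(* No assumption on the characteristic is needed: when 2 = 0 in F, 2^-1 = 0   *)
(* and the product is zero.                                                   *)
Fact jmulmx_jordan (X Y : 'M[F]_n) :
  jmulmx (jmulmx X X) (jmulmx X Y) = jmulmx X (jmulmx (jmulmx X X) Y).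
Proof.
have: X *m jmulmx X X = jmulmx X X *m X.
  by rewrite /jmulmx -scalemxAl -scalemxAr mulmxDl mulmxDr mulmxA.
move: (jmulmx X X) => S XS.
rewrite /jmulmx -!(scalemxAl, scalemxAr) -!scalerDr; do 2 congr (_ *: _).
rewrite !(mulmxDl, mulmxDr) !mulmxA XS -(mulmxA Y S X) -XS mulmxA.
exact: addrACA.
Qed.

HB.instance Definition _ := Zmodule_isJordanRing.Build 'M^+[F]_n
  jmulmxC jmulmxDl jmulmx_jordan.

Lemma jmulmxE (X Y : 'M^+[F]_n) : X ∘ Y = 2^-1 *: (X *m Y + Y *m X).
Proof. by []. Qed.

End JordanMatrix.

(* Main.v *)
(** After subtracting the idempotent [phi 0] one may assume [psi 0 = 0], and
    the point is that a multiplicative [psi] is then additive.  Let P be the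
    diagonal projection on the even coordinates and Q = 1 - P.  The cubic
    Peirce relation for [psi P], together with the orthogonality of [psi P]
    and [psi Q], shows that [psi] maps the Peirce half space of P to that of
    [psi P]; in particular it commutes with halving there.  The identity
    matrix is, up to an invertible diagonal factor, a product of two half
    matrices, hence [psi 1 = psi P + psi Q] and
    [psi X = psi (P ∘ X) + psi (Q ∘ X)].  The half component of
    (P + Y) ∘ (Q + Z) is (Y + Z)/2, which gives additivity on the half space.
    The defect [psi (X + Y) - psi X - psi Y] is then a sum of two elements, in
    the 1-spaces of [psi P] and [psi Q]; each is annihilated by the image of
    the half space, hence by products of such images, and vanishes because
    suitable products of half matrices have P, or Q, as diagonal block.  The
    last two claims follow from the simplicity of the Jordan ring of
    matrices. *)

Require Import Defs.
From HB Require Import structures.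
From mathcomp Require Import all_boot all_order all_algebra.

Set Implicit Arguments.
Unset Strict Implicit.

Import GRing.Theory.
Local Open Scope ring_scope.

(** * Reflexive decision of identities in abelian groups *)

Inductive zexpr := ZVar of nat | ZZero | ZAdd of zexpr & zexpr | ZOpp of zexpr.

Fixpoint zeval (V : zmodType) (env : seq V) e : V :=
  match e with
  | ZVar k => env`_k
  | ZZero => 0
  | ZAdd e1 e2 => zeval env e1 + zeval env e2
  | ZOpp e1 => - zeval env e1
  end.

Fixpoint zcoef e (i : nat) : int :=
  match e with
  | ZVar k => (i == k)%:Z
  | ZZero => 0
  | ZAdd e1 e2 => zcoef e1 i + zcoef e2 i
  | ZOpp e1 => - zcoef e1 i
  end.

(** Variables outside [env] evaluate to the default 0, so the sum up to [size env] misses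
    nothing. *)
Lemma zevalE (V : zmodType) (env : seq V) e :
  zeval env e = \sum_(i < size env) env`_i *~ zcoef e i.
Proof.
elim: e => [k||e1 IH1 e2 IH2|e1 IH1] /=.
- have [lt_k|le_k] := ltnP k (size env); last first.
    rewrite nth_default // big1 // => i _.
    by rewrite ltn_eqF // (leq_trans (ltn_ord i)).
  rewrite (bigD1 (Ordinal lt_k)) //= eqxx mulr1z big1 ?addr0 // => i.
  by rewrite -val_eqE /= => /negPf->.
- by rewrite big1.
- by rewrite IH1 IH2 -big_split; apply: eq_bigr => i _; rewrite mulrzDr.
- by rewrite IH1 -sumrN; apply: eq_bigr => i _; rewrite mulrNz.
Qed.

Lemma zevalP (V : zmodType) (env : seq V) e1 e2 :
  all (fun i => zcoef e1 i == zcoef e2 i) (iota 0 (size env)) ->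
  zeval env e1 = zeval env e2.
Proof.
move=> /allP e12; rewrite !zevalE; apply: eq_bigr => i _.
by rewrite (eqP (e12 i _)) // mem_iota add0n ltn_ord.
Qed.

Ltac zindex x env :=
  lazymatch env with
  | x :: _ => constr:(0%N)
  | _ :: ?env' => let k := zindex x env' in constr:(k.+1)
  end.

Ltac zmember x env :=
  lazymatch env with
  | nil => constr:(false)
  | x :: _ => constr:(true)
  | _ :: ?env' => zmember x env'
  end.

Ltac zatoms t env :=
  lazymatch t with
  | 0 => env
  | ?a + ?b => let env' := zatoms a env in zatoms b env'
  | - ?a => zatoms a env
  | _ => lazymatch zmember t env with
         | true => env
         | false => constr:(t :: env)
         end
  end.

Ltac zreify t env :=
  lazymatch t with
  | 0 => constr:(ZZero)
  | ?a + ?b => let a' := zreify a env in let b' := zreify b env in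
               constr:(ZAdd a' b')
  | - ?a => let a' := zreify a env in constr:(ZOpp a')
  | _ => let k := zindex t env in constr:(ZVar k)
  end.

Ltac zmod :=
  rewrite ?mulrS ?mulr0n;
  lazymatch goal with
  | |- @eq ?T ?a ?b =>
    let env := zatoms a (@nil T) in let env := zatoms b env in
    let a' := zreify a env in let b' := zreify b env in
    apply: (@zevalP _ env a' b'); vm_compute; reflexivity
  end.

Lemma eq_lin (V : zmodType) (l r a b : V) : l = r -> a - b = l - r -> a = b.
Proof. by move=> -> /eqP; rewrite subrr subr_eq0 => /eqP. Qed.

Ltac zmod_from H := apply: (@eq_lin _ _ _ _ _ H); zmod.

(** * Linearized Jordan identity and Peirce components *)

(** Only divisions by 2 occur: replacing [a] by [- a] separates [s a b], quadratic in [a], from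
    [s b a], linear in [a]; polarizing [s] in its quadratic variable then yields twice the cyclic
    sum. *)
Lemma two_torsion_free_polarize (J : jordanRingType) (t : J -> J -> J -> J) :
  two_torsion_free J ->
  (forall a a' b c, t (a + a') b c = t a b c + t a' b c) ->
  (forall a b c c', t a b (c + c') = t a b c + t a b c') ->
  (forall a b c, t a b c = t b a c) ->
  (forall a, t a a a = 0) ->
  forall x y z, t x y z + t y z x + t z x y = 0.
Proof.
move=> tf tDl tDr tC t0 x y z.
have tDm a b b' c : t a (b + b') c = t a b c + t a b' c.
  by rewrite tC tDl !(tC _ a).
have tNl a b c : t (- a) b c = - t a b c.
  have E : t 0 b c = 0 by apply: (addrI (t 0 b c)); rewrite -tDl !addr0.
  by apply: (addrI (t a b c)); rewrite -tDl !subrr.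
have tNr a b c : t a b (- c) = - t a b c.
  have E : t a b 0 = 0 by apply: (addrI (t a b 0)); rewrite -tDr !addr0.
  by apply: (addrI (t a b c)); rewrite -tDr !subrr.
pose s a b := t a a b + t a b a + t b a a.
have sD a b : s a b + s b a = 0.
  have := t0 (a + b); rewrite !(tDl, tDm, tDr) !t0 => E.
  by rewrite /s; zmod_from E.
have s0 a b : s a b = 0.
  apply: tf; have E1 := sD a b; have := sD (- a) b.
  rewrite /s !(tC b (- a)) !(tNl, tNr) !(tC a (- a)) !tNl => E2.
  move: E1; rewrite /s !(tC b a) => E1; zmod_from (congr2 +%R E1 E2).
have := s0 (x + y) z; have := s0 x z; have := s0 y z.
rewrite /s !(tDl, tDm, tDr) !(tC y x) !(tC z x) !(tC z y) => E1 E2 E3.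
apply: tf; zmod_from (congr2 +%R E3 (esym (congr2 +%R E1 E2))).
Qed.

Lemma jordan_linear (J : jordanRingType) (tf : two_torsion_free J)
    (x y z w : J) :
  (x ∘ y) ∘ (z ∘ w) + (y ∘ z) ∘ (x ∘ w) + (z ∘ x) ∘ (y ∘ w) =
  z ∘ ((x ∘ y) ∘ w) + x ∘ ((y ∘ z) ∘ w) + y ∘ ((z ∘ x) ∘ w).
Proof.
pose t a b c := (a ∘ b) ∘ (c ∘ w) - c ∘ ((a ∘ b) ∘ w).
have E : t x y z + t y z x + t z x y = 0.
  apply: two_torsion_free_polarize => // [a a' b c|a b c c'|a b c|a]; rewrite /t.
  - by rewrite !(jmulDl, jmulDr); zmod.
  - by rewrite !(jmulDl, jmulDr); zmod.
  - by rewrite (jmulC a).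
  - by rewrite jordan_identity subrr.
by rewrite /t in E; zmod_from E.
Qed.

Lemma idempotent_linear (J : jordanRingType) (tf : two_torsion_free J)
    (p z w : J) : jordan_idempotent p ->
  ((p ∘ z) ∘ (p ∘ w)) *+ 2 + p ∘ (z ∘ w) =
  (p ∘ ((p ∘ z) ∘ w)) *+ 2 + z ∘ (p ∘ w).
Proof.
move=> pp; have := jordan_linear tf p p z w; rewrite pp !(jmulC z p) => E.
by zmod_from E.
Qed.

(* The Peirce polynomial 2L^3 - 3L^2 + L of multiplication by an idempotent. *)
Lemma idempotent_cubic (J : jordanRingType) (tf : two_torsion_free J)
    (p z : J) : jordan_idempotent p ->
  (p ∘ (p ∘ z)) *+ 3 = (p ∘ (p ∘ (p ∘ z))) *+ 2 + p ∘ z.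
Proof.
move=> pp; have := idempotent_linear tf z p pp.
by rewrite pp ![_ ∘ p]jmulC => E; zmod_from E.
Qed.

(** The two orders of [x] and [y] in [idempotent_linear] give [p ∘ (x ∘ y) = x ∘ y] and
    [p ∘ (x ∘ y) = 0]. *)
Lemma peirce01_orthogonal (J : jordanRingType) (tf : two_torsion_free J)
    (p x y : J) : jordan_idempotent p -> p ∘ x = 0 -> p ∘ y = y -> x ∘ y = 0.
Proof.
move=> pp px py; have E1 := idempotent_linear tf x y pp.
have := idempotent_linear tf y x pp.
move: E1; rewrite px py !(jmulr0, jmul0r, mul0rn, addr0, add0r) (jmulC y).
by move=> -> E; zmod_from (esym E).
Qed.

Lemma peirce1_mul_half (J : jordanRingType) (tf : two_torsion_free J)
    (p x y : J) : jordan_idempotent p ->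
  p ∘ x = x -> (p ∘ y) *+ 2 = y -> (p ∘ (x ∘ y)) *+ 2 = x ∘ y.
Proof.
move=> pp px py; have := idempotent_linear tf x y pp; rewrite px => E.
have {E}-> : p ∘ (x ∘ y) = x ∘ (p ∘ y) by zmod_from (esym E).
by rewrite mulr2n -jmulDr -mulr2n py.
Qed.

Lemma half_mul_half (J : jordanRingType) (tf : two_torsion_free J)
    (p x y : J) : jordan_idempotent p ->
  (p ∘ x) *+ 2 = x -> (p ∘ y) *+ 2 = y -> p ∘ (p ∘ (x ∘ y)) = p ∘ (x ∘ y).
Proof.
move=> pp px py.
have half a b : (p ∘ a) *+ 2 = a -> (p ∘ b) *+ 2 = b ->
    b ∘ (p ∘ (p ∘ a)) = (p ∘ b) ∘ (p ∘ a).
  move=> pa pb; rewrite -{1}pb mulr2n jmulDl -jmulDr -jmulDr -mulr2n.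
  by rewrite pa.
have := jordan_linear tf p x y p.
rewrite pp !(jmulC _ p) (half _ _ px py) (half _ _ py px).
rewrite (jmulC (p ∘ y)) => E; zmod_from (esym E).
Qed.

Lemma jmulrMn (J : jordanRingType) (x y : J) n : x ∘ (y *+ n) = (x ∘ y) *+ n.
Proof. by elim: n => [|n IH]; rewrite ?jmulr0 // !mulrS jmulDr IH. Qed.

Definition peirce_half (J : jordanRingType) (p x : J) := (p ∘ x) *+ 2 = x.

Definition jordan_unit (J : jordanRingType) (u : J) := forall x, u ∘ x = x.

Section ComplementaryIdempotents.
Variables (A : jordanRingType) (one P Q : A).
Hypothesis tfA : two_torsion_free A.
Hypothesis oneE : jordan_unit one.
Hypothesis PP : jordan_idempotent P.
Hypothesis PQ1 : P + Q = one.

Lemma compl_mulE x : Q ∘ x = x - P ∘ x.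
Proof. by have := oneE x; rewrite -PQ1 jmulDl => E; zmod_from E. Qed.

Lemma compl_orthogonal : P ∘ Q = 0.
Proof. by rewrite jmulC compl_mulE PP subrr. Qed.

Lemma compl_idempotent : jordan_idempotent Q.
Proof. by rewrite /jordan_idempotent compl_mulE compl_orthogonal subr0. Qed.

Lemma compl_comm x : Q ∘ (P ∘ x) = P ∘ (Q ∘ x).
Proof. by rewrite !compl_mulE jmulDr jmulrN. Qed.

Lemma compl_half x : peirce_half P x -> Q ∘ x = P ∘ x.
Proof. by rewrite compl_mulE => h; zmod_from (esym h). Qed.

Lemma compl_peirce_half x : peirce_half P x -> peirce_half Q x.
Proof. by move=> h; rewrite /peirce_half compl_half. Qed.

(** With [L] the multiplication by [P], the operator here is [L(1 - L)], and the cubic relation is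
    [(2L - 1)L(1 - L) = 0]. It thus serves as the half projection, up to a factor 4. *)
Lemma peirce_half_compl x : peirce_half P (P ∘ (Q ∘ x)).
Proof.
have E := idempotent_cubic tfA x PP.
by rewrite /peirce_half compl_mulE !(jmulDr, jmulrN); zmod_from E.
Qed.

Lemma compl_half_mul_half x y :
  peirce_half P x -> peirce_half P y -> P ∘ (Q ∘ (x ∘ y)) = 0.
Proof.
by move=> hx hy; rewrite compl_mulE jmulDr jmulrN half_mul_half ?subrr.
Qed.

End ComplementaryIdempotents.

(** * Additivity of Jordan multiplicative maps *)

Section MultiplicativeMap.
Variables (A J : jordanRingType) (one P Q : A) (psi : A -> J).
Hypothesis tfA : two_torsion_free A.
Hypothesis tfJ : two_torsion_free J.
Hypothesis oneE : jordan_unit one.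
Hypothesis PP : jordan_idempotent P.
Hypothesis PQ1 : P + Q = one.
Hypothesis psiM : jordan_multiplicative psi.
Hypothesis psi0 : psi 0 = 0.

Let QE := compl_mulE oneE PQ1.
Let PQ := compl_orthogonal oneE PP PQ1.
Let QQ : jordan_idempotent Q := compl_idempotent oneE PP PQ1.
Let QP x : Q ∘ (P ∘ x) = P ∘ (Q ∘ x) := compl_comm oneE PQ1 x.

Let pp : jordan_idempotent (psi P).
Proof. by rewrite /jordan_idempotent -psiM PP. Qed.

Let pq : psi P ∘ psi Q = 0.
Proof. by rewrite -psiM PQ psi0. Qed.

(* [psi Z] could have a component in the 1-space of [psi P], but by symmetry  *)
(* the same element lies in the 1-space of the orthogonal idempotent [psi Q]. *)
Lemma multiplicative_half Z :
  peirce_half P Z -> peirce_half (psi P) (psi Z).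
Proof.
move=> hZ; have EZ : P ∘ (Z + Z) = Z by rewrite jmulDr -mulr2n hZ.
have QZ : Q ∘ Z = P ∘ Z by rewrite QE; zmod_from (esym hZ).
(* As [P ∘ (Z + Z) = Z], this relates [psi Z], [psi (P ∘ Z)] and [psi (P ∘ (P ∘ Z))], and says that
   [psi P] fixes [g] below. *)
have := idempotent_cubic tfJ (psi (Z + Z)) pp.
rewrite -!psiM EZ => E.
pose g := psi (P ∘ Z) *+ 2 - psi Z.
have pg : psi P ∘ g = g.
  by rewrite /g jmulDr mulr2n jmulDr jmulrN -!psiM; zmod_from (esym E).
have qg : psi Q ∘ g = g.
  rewrite /g jmulDr mulr2n jmulDr jmulrN -!psiM QP QZ; zmod_from (esym E).
have g0 : g = 0 by rewrite -qg; apply: peirce01_orthogonal pg.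
by move: g0; rewrite /g /peirce_half -psiM => g0; zmod_from g0.
Qed.

(* The defect idempotent [psi one - psi P - psi Q] annihilates every [psi X]  *)
(* with [X] half, hence also [psi one] as soon as some product of two half    *)
(* elements is invertible.                                                    *)
Lemma multiplicative_compl V W Y :
  peirce_half P V -> peirce_half P W -> P ∘ (Q ∘ Y) = 0 ->
  (V ∘ W) ∘ Y = one -> forall X, psi X = psi (P ∘ X) + psi (Q ∘ X).
Proof.
move=> hV hW PQY VWY.
have uE X : psi one ∘ psi X = psi X by rewrite -psiM oneE.
pose r := psi one - psi P - psi Q.
have rE X : r ∘ psi X = psi X - psi (P ∘ X) - psi (Q ∘ X).
  by rewrite /r !(jmulDl, jmulNr) uE -!psiM.
have rr : jordan_idempotent r.
  rewrite /jordan_idempotent {2}/r !(jmulDr, jmulrN) !rE.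
  by rewrite !(jmulC _ one) !oneE PP QQ (jmulC Q P) PQ psi0 /r; zmod.
have rhalf Z : peirce_half P Z -> r \in [pred r | r ∘ psi Z == 0].
  move=> hZ; rewrite inE rE.
  have := multiplicative_half hZ; rewrite /peirce_half -psiM => E.
  rewrite (compl_half oneE PQ1 hZ); apply/eqP; zmod_from (esym E).
have rVW : psi (V ∘ W) \in peirce0 r.
  by rewrite psiM; apply: peirce0_jmul_closed => //; apply: rhalf.
have PPY : P ∘ (P ∘ Y) = P ∘ Y.
  by move: PQY; rewrite QE jmulDr jmulrN => E; zmod_from (esym E).
have QQY : Q ∘ (Q ∘ Y) = Q ∘ Y.
  by rewrite (QE (Q ∘ Y)) PQY subr0.
(* [w] and [psi Y - w] are the parts of [psi Y] in the 0-space and 1-space of [r]; multiplication by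
   [psi (V ∘ W)], itself in the 0-space, kills the latter. *)
pose w := psi (P ∘ Y) + psi (Q ∘ Y).
have rw : w \in peirce0 r.
  rewrite inE /w jmulDr !rE PPY QQY QP PQY psi0.
  by apply/eqP; zmod.
have rz : r ∘ (psi Y - w) = psi Y - w.
  move: rw; rewrite inE jmulDr jmulrN => /eqP->; rewrite rE /w; zmod.
have : psi one \in peirce0 r.
  rewrite -VWY psiM -(subrK w (psi Y)) jmulDr.
  rewrite (peirce01_orthogonal tfJ rr _ rz);
    last by move: rVW; rewrite inE => /eqP.
  by rewrite add0r; apply: peirce0_jmul_closed.
have ror : r ∘ psi one = r by rewrite rE !(jmulC _ one) !oneE.
rewrite inE ror => /eqP r0 X.
by have := rE X; rewrite r0 jmul0r => E; zmod_from (esym E).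
Qed.

Hypothesis psi_compl : forall X, psi X = psi (P ∘ X) + psi (Q ∘ X).

(* The product (P + Y)(Q + Z) has half component (Y + Z)/2; its image splits  *)
(* because [psi (P + Y) - psi Y] and [psi (Q + Z) - psi Z] lie in orthogonal  *)
(* Peirce components.                                                         *)
Lemma multiplicative_additive_half Y Z :
  peirce_half P Y -> peirce_half P Z -> psi (Y + Z) = psi Y + psi Z.
Proof.
move=> hY hZ.
(* [T] divides half elements by 8, so additivity on its values suffices. It arises as [P ∘ (Q ∘ _)]
   applied to the terms [P ∘ Y] and [P ∘ Z] of the product. *)
pose T X := P ∘ (Q ∘ (P ∘ X)).
have TD : {morph T : x y / x + y} by move=> x y; rewrite /T !jmulDr.
have T8 X : peirce_half P X -> T (X *+ 8) = X.
  move=> hX; have M2 m : P ∘ (X *+ m.*2) = X *+ m.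
    by rewrite jmulrMn -muln2 mulnC mulrnA hX.
  have hX4 : peirce_half P (X *+ 4).
    by rewrite /peirce_half (M2 2) -mulrnA.
  by rewrite /T (M2 4) (compl_half oneE PQ1 hX4) (M2 2) (M2 1).
have half8 X : peirce_half P X -> peirce_half P (X *+ 8).
  by move=> hX; rewrite /peirce_half jmulrMn -mulrnAC hX.
suff {Y Z hY hZ} H Y Z : peirce_half P Y -> peirce_half P Z ->
    psi (T (Y + Z)) = psi (T Y) + psi (T Z).
  by rewrite -{1}(T8 _ hY) -{1}(T8 _ hZ) -TD H ?T8 //; apply: half8.
move=> hY hZ.
pose c := psi (P + Y) - psi Y; pose d := psi (Q + Z) - psi Z.
have qc : psi Q ∘ c = 0.
  rewrite /c jmulDr jmulrN -!psiM jmulDr (jmulC Q P) PQ add0r.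
  by rewrite subrr.
have pd : psi P ∘ d = 0.
  by rewrite /d jmulDr jmulrN -!psiM jmulDr PQ add0r subrr.
have pc : psi P ∘ c = c.
  move: qc; rewrite /c !jmulDr !jmulrN -!psiM => qc.
  have E1 := psi_compl (P + Y); have E2 := psi_compl Y.
  zmod_from (congr2 +%R (esym (congr2 +%R E1 qc)) E2).
have dc : d ∘ c = 0 by apply: peirce01_orthogonal pc.
have YZ0 : P ∘ (Q ∘ (Y ∘ Z)) = 0.
  exact: (compl_half_mul_half tfA oneE PP PQ1).
have QZ : Q ∘ Z = P ∘ Z by apply: (compl_half oneE PQ1).
have QY : Q ∘ Y = P ∘ Y by apply: (compl_half oneE PQ1).
have E : psi (P + Y) ∘ psi (Q + Z) = psi ((P + Y) ∘ Z) - psi (Y ∘ Z) +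
   psi (Y ∘ (Q + Z)).
  by move: dc; rewrite jmulC /c /d !(jmulDr, jmulrN) !(jmulDl, jmulNr);
    rewrite -!psiM !(jmulDl, jmulDr) => dc; zmod_from dc.
have := congr1 (fun x => psi P ∘ (psi Q ∘ x)) E.
rewrite !(jmulDr, jmulrN) -!psiM !(jmulDl, jmulDr) PQ (jmulC Y Q) QY YZ0 psi0.
rewrite !jmulr0 !addr0 add0r subr0 TD /T => ->; exact: addrC.
Qed.

(** The image of [psi] acts on defects through their arguments ([deltaM]), so Peirce components of a
    defect are again defects, and the half ones vanish. *)
Lemma multiplicative_additive_peirce1 V W :
  peirce_half P V -> peirce_half P W -> P ∘ (V ∘ W) = P ->
  forall X Y, psi P ∘ (psi (X + Y) - (psi X + psi Y)) = 0.
Proof.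
move=> hV hW PVW X Y.
pose delta X Y := psi (X + Y) - (psi X + psi Y).
have deltaM Z a b : psi Z ∘ delta a b = delta (Z ∘ a) (Z ∘ b).
  by rewrite /delta jmulDr jmulrN !jmulDr -!psiM jmulDr.
have delta_compl a b : delta a b = psi P ∘ delta a b + psi Q ∘ delta a b.
  rewrite !deltaM /delta -!jmulDr (psi_compl (a + b)) (psi_compl a).
  rewrite (psi_compl b); zmod.
have delta_half a b : psi P ∘ (psi Q ∘ delta a b) = 0.
  rewrite !deltaM /delta multiplicative_additive_half ?subrr //;
    exact: (peirce_half_compl tfA oneE PP PQ1).
pose d := psi P ∘ delta X Y.
have qd : psi Q ∘ d = 0 by rewrite -(delta_half X Y) /d !deltaM !QP.
have pd : psi P ∘ d = d.
  by have := delta_compl (P ∘ X) (P ∘ Y); rewrite -deltaM qd addr0.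
(* The product [t] is half for [psi P], but it is also a defect and so has no half component. *)
have dhalf Z : peirce_half P Z -> d ∘ psi Z = 0.
  move=> hZ; have := peirce1_mul_half tfJ pp pd (multiplicative_half hZ).
  set t := d ∘ psi Z => ht.
  have tE : t = delta (Z ∘ (P ∘ X)) (Z ∘ (P ∘ Y)).
    by rewrite /t jmulC /d !deltaM.
  have := delta_compl (Z ∘ (P ∘ X)) (Z ∘ (P ∘ Y)).
  have := delta_half (Z ∘ (P ∘ X)) (Z ∘ (P ∘ Y)).
  rewrite -tE => pqt tpq.
  have qt : psi Q ∘ t = psi P ∘ t.
    by zmod_from (congr2 +%R (esym tpq) (esym ht)).
  move: pqt; rewrite qt => ppt; move: (congr1 (jmul (psi P)) ht).
  by rewrite jmulrMn ppt mul0rn => pt; rewrite -ht -pt mul0rn.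
have dVW : d ∘ psi (V ∘ W) = 0.
  have hv : (psi V ∘ psi Q) *+ 2 = psi V.
    rewrite jmulC -psiM (compl_half oneE PQ1 hV) psiM.
    exact: multiplicative_half.
  (* Since [d] kills [psi V], [psi W] and [psi Q], the only surviving term is
     [d ∘ ((psi V ∘ psi Q) ∘ psi W)], which doubles to [d ∘ psi (V ∘ W)]. *)
  have := jordan_linear tfJ d (psi V) (psi Q) (psi W).
  rewrite qd (dhalf _ hV) (dhalf _ hW) !(jmulr0, jmul0r, addr0, add0r) => E.
  rewrite psiM -hv mulr2n jmulDl jmulDr; zmod_from (esym (congr2 +%R E E)).
have : d ∘ psi (V ∘ W) = d ∘ psi P.
  rewrite psi_compl PVW jmulDr [d ∘ psi (Q ∘ _)]jmulC.
  rewrite (peirce01_orthogonal tfJ pp _ pd) ?addr0 // -psiM.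
  by rewrite (compl_half_mul_half tfA oneE PP PQ1).
by rewrite dVW jmulC pd.
Qed.

End MultiplicativeMap.

(** The three existence hypotheses serve in turn the splitting of [psi] and the vanishing of the
    defect at [P] and, after exchanging the idempotents, at [Q]. *)
Lemma jordan_multiplicative_additive (A J : jordanRingType) (one P Q : A)
    (psi : A -> J) :
  two_torsion_free A -> two_torsion_free J -> jordan_unit one ->
  jordan_idempotent P -> P + Q = one ->
  (exists V W Y, [/\ peirce_half P V, peirce_half P W, P ∘ (Q ∘ Y) = 0
                   & (V ∘ W) ∘ Y = one]) ->
  (exists V W, [/\ peirce_half P V, peirce_half P W & P ∘ (V ∘ W) = P]) ->
  (exists V W, [/\ peirce_half P V, peirce_half P W & Q ∘ (V ∘ W) = Q]) ->
  jordan_multiplicative psi -> psi 0 = 0 -> {morph psi : X Y / X + Y}.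
Proof.
move=> tfA tfJ oneE PP PQ1 [V [W [Z [hV hW PQZ VWZ]]]].
move=> [V1 [W1 [hV1 hW1 PVW]]] [V2 [W2 [hV2 hW2 QVW]]] psiM psi0 X Y.
have psi_compl := multiplicative_compl tfJ oneE PP PQ1 psiM psi0 hV hW PQZ VWZ.
have QP1 : Q + P = one by rewrite addrC.
have QQ := compl_idempotent oneE PP PQ1.
have hQ := compl_peirce_half oneE PQ1.
have p0 := multiplicative_additive_peirce1 tfA tfJ oneE PP PQ1 psiM psi0
  psi_compl hV1 hW1 PVW X Y.
have q0 : psi Q ∘ (psi (X + Y) - (psi X + psi Y)) = 0.
  apply: (multiplicative_additive_peirce1 tfA tfJ oneE QQ QP1 psiM psi0 _
    (hQ _ hV2) (hQ _ hW2) QVW).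
  by move=> T; rewrite psi_compl addrC.
move: p0 q0; rewrite !(jmulDr, jmulrN) -!psiM !jmulDr => p0 q0.
have E1 := psi_compl X; have E2 := psi_compl Y.
have := psi_compl (X + Y); rewrite !jmulDr => E3.
zmod_from (congr2 +%R (congr2 +%R p0 q0)
  (congr2 +%R E3 (esym (congr2 +%R E1 E2)))).
Qed.

(** * Jordan rings of matrices *)

Section JordanMatrices.
Variables (F : fieldType) (n : nat).
Hypothesis two_neq0 : (2 : F) != 0.
Implicit Types X Y Z : 'M^+[F]_n.

Lemma jmulmx_double X Y : (X ∘ Y) *+ 2 = X *m Y + Y *m X.
Proof. by rewrite jmulmxE -scaler_nat scalerA divff // scale1r. Qed.

Lemma jordan_matrix_two_torsion_free : two_torsion_free 'M^+[F]_n.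
Proof.
move=> X X0; apply/eqP; move/eqP: X0.
by rewrite -scaler_nat scaler_eq0 (negPf two_neq0).
Qed.

Lemma jordan_matrix_unit : jordan_unit (1%:M : 'M^+[F]_n).
Proof.
move=> X; rewrite jmulmxE mul1mx mulmx1 -mulr2n -scaler_nat scalerA mulVf //.
by rewrite scale1r.
Qed.

Lemma jmul_diag_mx (a b : 'rV[F]_n) :
  (diag_mx a : 'M^+[F]_n) ∘ (diag_mx b : 'M^+[F]_n) =
  diag_mx (\row_i (a 0 i * b 0 i)).
Proof.
rewrite jmulmxE !mulmx_diag.
have -> : \row_i (b 0 i * a 0 i) = \row_i (a 0 i * b 0 i).
  by apply/rowP => i; rewrite !mxE mulrC.
by rewrite -mulr2n -scaler_nat scalerA mulVf // scale1r.
Qed.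

Definition even_mx : 'M^+[F]_n := diag_mx (\row_i (~~ odd i)%:R).
Definition odd_mx : 'M^+[F]_n := diag_mx (\row_i (odd i)%:R).
Definition superdiag_mx (w : nat -> F) : 'M^+[F]_n :=
  \matrix_(i, j) (w i *+ (j == i.+1 :> nat)).
Definition subdiag_mx : 'M^+[F]_n := \matrix_(i, j) (i == j.+1 :> nat)%:R.

Lemma even_mx_idempotent : jordan_idempotent even_mx.
Proof.
rewrite /jordan_idempotent jmul_diag_mx; congr diag_mx.
by apply/rowP => i; rewrite !mxE; case: odd; rewrite ?mulr0 ?mulr1.
Qed.

Lemma even_odd_mx : even_mx + odd_mx = 1%:M.
Proof.
apply/matrixP => i j; rewrite !mxE -mulrnDl.
by case: odd; rewrite ?addr0 ?add0r.
Qed.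

(** Neighbouring indices have opposite parity, so each entry survives on exactly one side. *)
Lemma superdiag_mx_half w : peirce_half even_mx (superdiag_mx w).
Proof.
rewrite /peirce_half jmulmx_double mul_diag_mx mul_mx_diag.
apply/matrixP => i j; rewrite !mxE; have [->|_] := eqVneq (j : nat) i.+1.
  rewrite /= negbK mulr1n.
  by case: odd; rewrite ?(mul0r, mul1r, mulr0, mulr1, add0r, addr0).
by rewrite mulr0n mulr0 mul0r addr0.
Qed.

Lemma subdiag_mx_half : peirce_half even_mx subdiag_mx.
Proof.
rewrite /peirce_half jmulmx_double mul_diag_mx mul_mx_diag.
apply/matrixP => i j; rewrite !mxE; have [->|_] := eqVneq (i : nat) j.+1.
  rewrite /= negbK.
  by case: odd; rewrite ?(mul0r, mul1r, mulr0, mulr1, add0r, addr0).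
by rewrite mulr0 mul0r addr0.
Qed.

(* The term [w i.-1] carries no junk: it is dropped at [i = 0].  The weights   *)
(* [w] can be chosen so that the product is invertible, or restricts to the   *)
(* identity on the even (resp. odd) coordinates, for either parity of n.      *)
Lemma super_sub_diag_mx w :
  superdiag_mx w ∘ subdiag_mx =
  diag_mx (\row_(i < n) (2^-1 * (w i *+ (i.+1 < n)%N + w i.-1 *+ (0 < i)%N))).
Proof.
rewrite jmulmxE; apply/matrixP => i j; rewrite !mxE -mulrnAr mulrnDl.
congr (_ * (_ + _)).
- under eq_bigr do rewrite !mxE mulr_natr -mulrnA mulnb.
  have [lt_i|le_i] := ltnP i.+1 n; last first.
    rewrite mulr0n mul0rn big1 // => k _.
    by rewrite ltn_eqF ?mulr0n // (leq_trans (ltn_ord k)).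
  rewrite (bigD1 (Ordinal lt_i)) //= eqxx eqSS big1 ?addr0 ?mulr1n // => k.
  by rewrite -val_eqE /= => /negPf->; rewrite mulr0n.
- under eq_bigr do rewrite !mxE mulr_natl -mulrnA mulnb.
  case: i => [[|i] lt_i] /=.
    by rewrite mulr0n mul0rn big1 // => k _; rewrite andbF mulr0n.
  rewrite (bigD1 (Ordinal (ltnW lt_i))) //= eqxx andbT mulr1n.
  rewrite big1 ?addr0 => [|k]; first by rewrite eq_sym.
  by rewrite -val_eqE eqSS eq_sym /= => /negPf->; rewrite andbF mulr0n.
Qed.

Lemma jordan_matrix_multiplicative_additive (J : jordanRingType)
    (psi : 'M^+[F]_n -> J) :
  (2 <= n)%N -> two_torsion_free J ->
  jordan_multiplicative psi -> psi 0 = 0 -> {morph psi : X Y / X + Y}.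
Proof.
move=> n_ge2 tfJ psiM psi0.
apply: (jordan_multiplicative_additive jordan_matrix_two_torsion_free tfJ
  jordan_matrix_unit even_mx_idempotent even_odd_mx) => //.
- pose d := \row_(i < n) (2^-1 * (1 *+ (i.+1 < n)%N + 1 *+ (0 < i)%N)) : 'rV[F]_n.
  exists (superdiag_mx (fun=> 1)), subdiag_mx, (diag_mx (\row_i (d 0 i)^-1)).
  split; [exact: superdiag_mx_half | exact: subdiag_mx_half | |].
    rewrite !jmul_diag_mx; apply/matrixP => i j; rewrite !mxE.
    by case: odd; rewrite ?(mul0r, mulr0) mul0rn.
  rewrite super_sub_diag_mx jmul_diag_mx -diag_const_mx; congr diag_mx.
  apply/rowP => i; rewrite !mxE mulfV // mulf_neq0 ?invr_neq0 //.
  (* As [n >= 2], every index has one or two neighbours, and both 1 and 2 are nonzero in [F]. *)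
  have [lt_i|le_i] := ltnP i.+1 n.
    by case: (0 < i)%N; rewrite ?addr0 ?oner_eq0.
  by rewrite -ltnS (leq_trans n_ge2) // add0r oner_eq0.
(* An even [i > 0] gets its 2 from [w i.-1]; the index 0 has no predecessor and gets it from
   [w 0]. *)
- exists (superdiag_mx (fun i => if odd i || (i == 0)%N then 2 else 0)).
  exists subdiag_mx.
  split; [exact: superdiag_mx_half | exact: subdiag_mx_half |].
  rewrite super_sub_diag_mx jmul_diag_mx; congr diag_mx.
  apply/rowP => -[[|i] lt_i]; rewrite !mxE /=.
    by rewrite n_ge2 addr0 mulVf // mulr1.
  case: (odd i) => /=; last by rewrite mul0r.
  by rewrite mul0rn add0r mulVf // mulr1.
- exists (superdiag_mx (fun i => if odd i then 0 else 2)), subdiag_mx.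
  split; [exact: superdiag_mx_half | exact: subdiag_mx_half |].
  rewrite super_sub_diag_mx jmul_diag_mx; congr diag_mx.
  apply/rowP => -[[|i] lt_i]; rewrite !mxE /= ?mul0r //.
  case: (odd i) => /=; first by rewrite mul0r.
  by rewrite mul0rn add0r mulVf // mulr1.
Qed.

(** The Jordan triple product: kernels of Jordan homomorphisms into 2-torsion-free rings are
    therefore stable under these two-sided products. *)
Lemma jmulmx_triple X Y Z :
  (Y *m X *m Z + Z *m X *m Y : 'M^+[F]_n) *+ 2 =
  (Y ∘ (Z ∘ X)) *+ 4 + (Z ∘ (Y ∘ X)) *+ 4 - ((Y ∘ Z) ∘ X) *+ 4.
Proof.
have E (U T S : 'M^+[F]_n) : (U ∘ (T ∘ S)) *+ 4 =
    U *m T *m S + U *m S *m T + (T *m S *m U + S *m T *m U).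
  rewrite (mulrnA _ 2 2) -jmulrMn !jmulmx_double.
  by rewrite mulmxDr mulmxDl !mulmxA.
by rewrite !E (jmulC (Y ∘ Z)) E; zmod.
Qed.

Lemma mulmx_delta_delta (a i j b : 'I_n) (X : 'M[F]_n) :
  delta_mx a i *m X *m delta_mx j b = X i j *: delta_mx a b.
Proof.
apply/matrixP => k l; rewrite !mxE (bigD1 j) //= big1 ?addr0 => [|m /negPf jm].
  rewrite !mxE (bigD1 i) //= big1 ?addr0 => [|m /negPf im].
    rewrite !mxE !eqxx andbT /=.
    by case: (k == a); case: (l == b); rewrite ?(mulr0, mulr1, mul0r, mul1r).
  by rewrite !mxE im andbF mul0r.
by rewrite !mxE jm mulr0.
Qed.

(** A nonzero entry [X i j] puts [delta_mx j i] in the kernel, then every [delta_mx m m], hence the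
    identity. *)
Lemma jordan_matrix_hom_kernel (J : jordanRingType) (f : 'M^+[F]_n -> J) :
  two_torsion_free J -> jordan_hom f ->
  forall X, X != 0 -> f X = 0 -> forall Y, f Y = 0.
Proof.
move=> tfJ [fD fM] X X_neq0 fX0.
have f0 : f 0 = 0 by apply: (addrI (f 0)); rewrite -fD !addr0.
have fB Y Z : f (Y - Z) = f Y - f Z.
  by rewrite fD; congr (_ + _); apply: (addrI (f Z)); rewrite -fD !subrr.
have fMn Y m : f (Y *+ m) = f Y *+ m.
  by elim: m => // m IH; rewrite !mulrS fD IH.
have fU Z Y T : f Z = 0 -> f (Y *m Z *m T + T *m Z *m Y) = 0.
  move=> fZ; apply: tfJ; rewrite -fMn jmulmx_triple fB fD !fMn !fM fZ.
  by rewrite !(jmulr0, mul0rn, addr0, subr0).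
(* [f] is only additive, so scalars are cancelled by Jordan multiplication with a scalar matrix. *)
have fZ c Z : c != 0 -> f (c *: Z : 'M[F]_n) = 0 -> f Z = 0.
  move=> c0 fcZ.
  have -> : Z = (c^-1%:M : 'M^+[F]_n) ∘ (c *: Z : 'M[F]_n).
    rewrite jmulmxE mul_scalar_mx mul_mx_scalar scalerA mulVf // scale1r.
    by rewrite -mulr2n -scaler_nat scalerA mulVf // scale1r.
  by rewrite fM fcZ jmulr0.
have /matrix0Pn[i [j Xij]] := X_neq0.
have fji : f (delta_mx j i) = 0.
  have := fU X (delta_mx j i) (delta_mx j i) fX0; rewrite mulmx_delta_delta.
  rewrite -mulr2n -scaler_nat scalerA; apply: fZ.
  by rewrite mulf_neq0.
have fmm m : f (delta_mx m m) = 0.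
  have := fU _ (delta_mx m j) (delta_mx i m) fji.
  rewrite !mulmx_delta_delta !mxE !eqxx scale1r.
  (* The second product is nonzero only for [i = j = m], where it doubles the first. *)
  have [<-|_] := eqVneq m j; have [<-|_] //= := eqVneq m i;
    rewrite ?scale0r ?addr0 //.
  by rewrite scale1r -mulr2n -scaler_nat; apply: fZ.
have f1 : f (1%:M : 'M[F]_n) = 0.
  by rewrite mx1_sum_delta (big_morph f fD f0) big1.
by move=> Y; rewrite -(jordan_matrix_unit Y) fM f1 jmul0r.
Qed.

End JordanMatrices.

Unset Implicit Arguments.
Set Strict Implicit.

Theorem theorem1p1 (F : fieldType) (charF : 2%N \notin [pchar F])
    (n : nat) (n_ge2 : (2 <= n)%N)
    (J : jordanRingType) (tfJ : two_torsion_free J)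
    (phi : 'M^+[F]_n -> J) :
  [/\ jordan_multiplicative phi <->
        jordan_idempotent (phi 0) /\
        exists psi : 'M^+[F]_n -> J,
          jordan_hom_to_peirce0 (phi 0) psi /\
          (forall X, phi X = phi 0 + psi X),
      jordan_multiplicative phi ->
        forall psi : 'M^+[F]_n -> J,
          jordan_hom_to_peirce0 (phi 0) psi ->
          (forall X, phi X = phi 0 + psi X) ->
          (forall X, psi X = 0) \/ injective psi
    & jordan_multiplicative phi ->
        (exists2 c : J, jordan_idempotent c & forall X, phi X = c) \/
        injective phi].
Proof.
have two_neq0 : (2 : F) != 0 by [].
have zero_or_inj (psi : 'M^+[F]_n -> J) : jordan_hom psi ->
    (forall X, psi X = 0) \/ injective psi.
  move=> psi_hom; have [psi1|psi1] := eqVneq (psi 1%:M) 0.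
    left=> X; rewrite -(jordan_matrix_unit two_neq0 X) psi_hom.2 psi1.
    exact: jmul0r.
  right=> X Y eqXY; apply/eqP; rewrite -subr_eq0; apply: contraNT psi1 => XY0.
  apply/eqP/(jordan_matrix_hom_kernel two_neq0 tfJ psi_hom XY0).
  by apply: (addIr (psi Y)); rewrite -psi_hom.1 subrK add0r.
have decompose : jordan_multiplicative phi ->
    jordan_idempotent (phi 0) /\
    jordan_hom_to_peirce0 (phi 0) (fun X => phi X - phi 0).
  move=> phiM.
  (* As [phi 0] absorbs every [phi X], subtracting it preserves multiplicativity and lands in its
     0-space. *)
  have e_phi X : phi 0 ∘ phi X = phi 0 by rewrite -phiM jmul0r.
  have psiM : jordan_multiplicative (fun X => phi X - phi 0).
    move=> X Y; rewrite !(jmulDl, jmulDr, jmulNr, jmulrN) -phiM.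
    by rewrite (jmulC (phi X)) !e_phi; zmod.
  split; [exact: e_phi | split; [split=> // | move=> X]].
    by apply: jordan_matrix_multiplicative_additive => //; rewrite subrr.
  by rewrite inE jmulDr jmulrN !e_phi subrr.
have phiE X : phi X = phi 0 + (phi X - phi 0) by rewrite addrC subrK.
split=> [|_ psi [psi_hom _] _|phiM].
- split=> [/decompose[ee psiP]|[ee [psi [[[_ psiM] psi0] phi_psi]]] X Y].
    by split=> //; exists (fun X => phi X - phi 0).
  have e_psi Z : phi 0 ∘ psi Z = 0 by have := psi0 Z; rewrite inE => /eqP.
  rewrite (phi_psi X) (phi_psi Y) (phi_psi (X ∘ Y)) psiM.
  rewrite !(jmulDl, jmulDr) ee e_psi.
  by rewrite (jmulC (psi X) (phi 0)) e_psi add0r addr0.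
- exact: zero_or_inj.
- have [ee [/zero_or_inj[psi0|psi_inj] _]] := decompose phiM.
    by left; exists (phi 0) => // X; rewrite phiE psi0 addr0.
  by right=> X Y eqXY; apply: psi_inj; rewrite eqXY.
Qed.
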